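(* Let $R$ be a ring. An $R$-module $M$ is a cl.Hilbert module if and only if every non-maximal classical prime submodule of $M$ is an intersection of properly larger classical prime submodules of $M$.
   Context: All rings are commutative with identity $1\neq 0$ and all modules are unital. A proper submodule $P$ of an $R$-module $M$ is classical prime if for all $a,b\in R$ and $m\in M$, $abm\in P$ implies $am\in P$ or $bm\in P$. An $R$-module $M$ is a cl.Hilbert module (classical Hilbert module) if every classical prime submodule of $M$ is an intersection of maximal submodules of $M$. *)

(* Defs.v *)
From HB Require Import structures.
From mathcomp Require Import all_boot all_algebra.
From mathcomp Require Import boolp classical_sets.

Set Implicit Arguments.
Unset Strict Implicit.
Unset Printing Implicit Defensive.

Import GRing.Theory.
Local Open Scope classical_set_scope.
Local Open Scope ring_scope.

Section ClassicalHilbertModules.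
Variables (R : comNzRingType) (M : lmodType R).
Implicit Types (P N : set M) (C : set (set M)).

Definition proper_submodule P : Prop := submod_closed (mem P) /\ P <> setT.

Definition maximal_submodule P : Prop :=
  proper_submodule P /\ forall N, proper_submodule N -> P `<=` N -> N = P.

Definition classical_prime P : Prop :=
  proper_submodule P /\
  forall (a b : R) (m : M), P ((a * b) *: m) -> P (a *: m) \/ P (b *: m).

(* The empty family is allowed: its intersection is setT, which is never a
   proper submodule. *)
Definition is_intersection_of C P : Prop :=
  exists2 F : set (set M), F `<=` C & P = \bigcap_(N in F) N.

Definition cl_Hilbert : Prop :=
  forall P, classical_prime P -> is_intersection_of maximal_submodule P.

End ClassicalHilbertModules.

Arguments cl_Hilbert {R} M.

(* Main.v *)
Require Import Defs.
From HB Require Import structures.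
From mathcomp Require Import all_boot all_algebra.
From mathcomp Require Import boolp classical_sets.
Import GRing.Theory.
Local Open Scope classical_set_scope.
Local Open Scope ring_scope.

(** A maximal submodule P is classical prime: if a m is not in P, then
    m = p + r a m with p in P, so b m = b p + r (a b m) lies in P whenever
    a b m does. Hence the maximal submodules used in a cl.Hilbert module are
    themselves larger classical primes. Conversely, given a classical prime P
    and m outside P, Zorn's lemma yields a classical prime Q containing P that
    is maximal among those avoiding m. Every larger classical prime contains m,
    so Q is not an intersection of such, and therefore Q is a maximal
    submodule. *)

Lemma submod_closedP (R : comNzRingType) (M : lmodType R) (P : set M) :
  submod_closed (mem P) <->
  P 0 /\ forall (a : R) (x y : M), P x -> P y -> P (a *: x + y).
Proof.
split=> [[P0 PD]|[P0 PD]].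
  split=> [|a x y Px Py]; first exact: set_mem P0.
  by apply: set_mem; apply: PD; apply: mem_set.
split=> [|a x y /set_mem Px /set_mem Py]; first exact: mem_set P0.
by apply: mem_set; apply: PD.
Qed.

Lemma maximal_classical_prime (R : comNzRingType) (M : lmodType R) (P : set M) :
  maximal_submodule P -> classical_prime P.
Proof.
move=> [[/submod_closedP [P0 PD] PT] Pmax].
have PZ (a : R) x : P x -> P (a *: x).
  by move=> Px; rewrite -[_ *: _]addr0; apply: PD.
split=> [|a b m Pabm]; first by split=> //; apply/submod_closedP.
have [Pam|nPam] := pselect (P (a *: m)); [by left | right].
(* [N] is the sum of [P] and the cyclic submodule generated by [a *: m]; it is larger than [P], so
   maximality makes it all of [M]. *)
pose N : set M := [set x | exists r : R, P (x - r *: (a *: m))].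
have PN : P `<=` N by move=> x Px; exists 0; rewrite scale0r subr0.
have Nam : N (a *: m) by exists 1; rewrite scale1r subrr.
have closedN : submod_closed (mem N).
  apply/submod_closedP; split=> [|c x y [r Pr] [s Ps]]; first exact: PN.
  exists (c * r + s).
  rewrite scalerDl -scalerA opprD addrACA -scalerBr; exact: PD.
have NT : N = setT.
  apply: contrapT => nNT; apply: nPam.
  by rewrite -(Pmax N).
have [r Pr] : N m by rewrite NT.
rewrite -[m](subrK (r *: (a *: m))) scalerDr; apply: PD => //.
have -> : b *: (r *: (a *: m)) = r *: ((a * b) *: m).
  by rewrite !scalerA [b * r]mulrC -mulrA [b * a]mulrC.
exact: PZ.
Qed.

(** Primeness passes to the union because its premise is a single membership; totality gives closure
    under sums, and the avoided [m] keeps the union proper. *)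
Lemma bigcup_chain_classical_prime (R : comNzRingType) (M : lmodType R)
    (F : set (set M)) (m : M) :
  F !=set0 -> total_on F subset -> F `<=` @classical_prime R M ->
  (forall N, F N -> ~ N m) -> classical_prime (\bigcup_(N in F) N).
Proof.
move=> [N0 FN0] Ftot Fcp Fm; split; last first.
  move=> a b x [N FN Nabx].
  by have [] := (Fcp _ FN).2 _ _ _ Nabx; [left | right]; exists N.
split; last by move=> FT; have [N /Fm] : (\bigcup_(N in F) N) m by rewrite FT.
have closedF N (FN : F N) := (submod_closedP _ _ N).1 (Fcp _ FN).1.1.
apply/submod_closedP; split; first by exists N0 => //; case: (closedF _ FN0).
move=> a x y [N FN Nx] [N' FN' N'y].
have [NN'|N'N] := Ftot _ _ FN FN'.
  by exists N' => //; apply: (closedF _ FN').2 => //; apply: NN'.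
by exists N => //; apply: (closedF _ FN).2 => //; apply: N'N.
Qed.

Lemma exists_maximal_avoiding_classical_prime (R : comNzRingType)
    (M : lmodType R) (P : set M) (m : M) :
  classical_prime P -> ~ P m ->
  exists Q, [/\ classical_prime Q, P `<=` Q, ~ Q m &
    forall N, classical_prime N -> Q `<` N -> N m].
Proof.
move=> cpP nPm.
(* Zorn_bigcup also demands the union of the empty chain, hence the [P `|` A]. *)
pose D : set (set M) := [set A | classical_prime (P `|` A) /\ ~ (P `|` A) m].
have [F FD Ftot|A [[cpA nAm] Amax]] := @Zorn_bigcup _ D.
  have [->|/set0P [X0 FX0]] := eqVneq F set0.
    by rewrite bigcup_set0; split; rewrite setU0.
  (* Adjoining [P] to each member turns [F] into a chain of classical primes; the witness [X0] keeps
     it nonempty. *)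
  pose G := [set P `|` X | X in F].
  have eqG : P `|` \bigcup_(X in F) X = \bigcup_(N in G) N.
    rewrite /G bigcup_image; apply/seteqP; split=> x.
      by case=> [Px|[X FX Xx]]; [exists X0 => //; left | exists X => //; right].
    by case=> X FX [Px|Xx]; [left | right; exists X].
  have Gm N : G N -> ~ N m by case=> X /FD [_ nXm] <-.
  split; rewrite eqG; last by case=> N /Gm.
  apply: (@bigcup_chain_classical_prime _ _ _ m) => //.
  - by exists (P `|` X0); exists X0.
  - move=> _ _ [X FX <-] [Y FY <-].
    by have [XY|YX] := Ftot _ _ FX FY; [left | right]; apply: setUS.
  - by move=> _ [X /FD [cpX _] <-].
exists (P `|` A); split=> // N cpN [QN nNQ].
(* As [N] contains [P], adjoining [P] does not change it, so [N] would lie in [D] strictly above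
   [A]. *)
apply: contrapT => nNm; apply: (Amax N).
  split; first by move=> x Ax; apply: QN; right.
  by move=> NA; apply: nNQ => x /NA; right.
have PN : P `<=` N by move=> x Px; apply: QN; left.
by split; rewrite setUidr.
Qed.

Theorem theorem2p5 (R : comNzRingType) (M : lmodType R) :
  cl_Hilbert M <->
  (forall P : set M, classical_prime P -> ~ maximal_submodule P ->
     is_intersection_of [set N : set M | classical_prime N /\ P `<` N] P).
Proof.
split=> [HM P cpP nmaxP|HM P cpP].
  have [F Fmax PE] := HM P cpP; exists F => // N FN.
  split; first exact: maximal_classical_prime (Fmax _ FN).
  rewrite properEneq; split; last by rewrite PE; exact: bigcap_inf.
  by apply/eqP => PN; apply: nmaxP; rewrite PN; apply: Fmax.
(* Taking all maximal submodules above [P] gives the smallest possible intersection. *)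
exists [set N | maximal_submodule N /\ P `<=` N]; first by move=> N [].
apply/seteqP; split=> [x Px N [_ PN]|m Pm]; first exact: PN.
apply: contrapT => nPm.
have [Q [cpQ PQ nQm Qmax]] :=
  exists_maximal_avoiding_classical_prime _ _ _ _ cpP nPm.
have [maxQ|nmaxQ] := pselect (maximal_submodule Q); first exact: nQm (Pm Q _).
have [F FQ eqQ] := HM Q cpQ nmaxQ.
by apply: nQm; rewrite eqQ => N /FQ [cpN QN]; apply: Qmax.
Qed.
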